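(* Let $$\tfrac13<r<3,\quad 0<b<\tfrac{2}{3+r},\quad 0\le m<1-\tfrac12b(1+r),\quad 0\le n<1-\tfrac12b(3-r),$$ let $s_1,s_2\in\{+1,-1\}$, and for $t\ge2$ set $$\Omega(t):=\{(x,y)\in\mathbb{R}^2 : |x+s_1t^m|<t^b,\ |y+s_2t^n|<t^{br}\}.$$ Let $u_0\in L^2(\mathbb{R}^2)$ and let $u=u(x,y,t)$, $u\in C(\mathbb{R}:L^2(\mathbb{R}^2))$, be the (bounded in time) solution of the two-dimensional Zakharov-Kuznetsov equation $\partial_tu+\partial_x\Delta u+u\,\partial_xu=0$ with $u(0)=u_0$. Then $$\liminf_{t\to\infty}\int_{\Omega(t)}u^2(x,y,t)\,dx\,dy=0.$$
   Context: Here $u$ is real valued, $\Delta=\partial_x^2+\partial_y^2$. The 2D Zakharov-Kuznetsov equation is globally well-posed in $L^2(\mathbb{R}^2)$ (a known result); ''the solution'' is the unique global one given by that theory, and it conserves the $L^2(\mathbb{R}^2)$ norm. *)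

(* Defs.v *)
From HB Require Import structures.
From mathcomp Require Import all_boot all_order all_algebra.
From mathcomp Require Import all_classical all_reals all_analysis.

Set Implicit Arguments.
Unset Strict Implicit.
Unset Printing Implicit Defensive.

Import Order.TTheory GRing.Theory Num.Theory.
Import numFieldNormedType.Exports.

Local Open Scope classical_set_scope.
Local Open Scope ring_scope.

Definition leb2 (R : realType) :
    {measure set (measurableTypeR R * measurableTypeR R) -> \bar R} :=
  (@lebesgue_measure R \x @lebesgue_measure R)%E.

(* C^oo: iterated directional derivatives of every order exist and are
   continuous. *)
Definition smooth (R : realType) (V : normedModType R) (f : V -> R) : Prop :=
  forall vs : seq V,
    let g : V -> R := foldr (fun v h => 'D_v h) f vs in
    continuous g /\ forall (z v : V), derivable g z v.

(* Space-time R x R^2; its points are written (t, (x, y)). *)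
Definition spacetime (R : realType) : normedModType R := (R * (R * R))%type.

Definition test_function (R : realType) (phi : spacetime R -> R) : Prop :=
  smooth phi /\ compact (closure [set z | phi z != 0]).

Definition Dt (R : realType) (phi : spacetime R -> R) : spacetime R -> R :=
  'D_((1, (0, 0)) : spacetime R) phi.
Definition Dx (R : realType) (phi : spacetime R -> R) : spacetime R -> R :=
  'D_((0, (1, 0)) : spacetime R) phi.
Definition Dy (R : realType) (phi : spacetime R -> R) : spacetime R -> R :=
  'D_((0, (0, 1)) : spacetime R) phi.

Definition laplacian (R : realType) (phi : spacetime R -> R) :
    spacetime R -> R :=
  fun z => Dx (Dx phi) z + Dy (Dy phi) z.

(* u in C(R : L^2(R^2)); u t is a Borel representative of the class at time
   t. *)
Definition continuous_L2 (R : realType) (u : R -> R * R -> R) : Prop :=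
  (forall t, u t \in Lfun (leb2 R) 2%:E) /\
  (forall t0,
    ('N[leb2 R]_2%:E[EFin \o (u t \- u t0)%R])%E @[t --> t0] --> 0%E).

(* sup_t ||u(t)||_{L^2(R^2)} < +oo *)
Definition bounded_L2 (R : realType) (u : R -> R * R -> R) : Prop :=
  exists M : R, forall t, ('N[leb2 R]_2%:E[EFin \o u t] <= M%:E)%E.

(* d_t u + d_x (Delta u) + u d_x u = 0 in D'(R x R^2), with the nonlinearity
   in divergence form d_x (u^2 / 2): all derivatives are moved to phi, which
   changes the sign of each of the three terms. For u in C(R : L^2) the inner
   integral is continuous and compactly supported in t, so both (real-valued)
   integrals converge and joint measurability of u in (t, x, y) is not
   needed. *)
Definition ZK_distributional (R : realType) (u : R -> R * R -> R) : Prop :=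
  forall phi : spacetime R -> R, test_function phi ->
    \int[@lebesgue_measure R]_t \int[leb2 R]_p
      (u t p * (Dt phi (t, p) + Dx (laplacian phi) (t, p))
       + 2^-1 * u t p ^+ 2 * Dx phi (t, p)) = 0.

(* u solves the Zakharov-Kuznetsov equation in C(R : L^2(R^2)), u(0) = u0. *)
Definition ZK_solution (R : realType) (u0 : R * R -> R)
    (u : R -> R * R -> R) : Prop :=
  [/\ continuous_L2 u,
      {ae leb2 R, forall p, u 0 p = u0 p} &
      ZK_distributional u].

Definition Omega (R : realType) (b r m n s1 s2 t : R) : set (R * R) :=
  [set p | `|p.1 + s1 * t `^ m| < t `^ b /\
           `|p.2 + s2 * t `^ n| < t `^ (b * r)].

(* Main.v *)
Require Import Defs.
From HB Require Import structures.
From mathcomp Require Import all_boot all_order all_algebra.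
From mathcomp Require Import all_classical all_reals all_analysis.
From mathcomp Require Import measurable_realfun.
From mathcomp Require Import ring lra.

Import Order.TTheory GRing.Theory Num.Theory.
Import numFieldNormedType.Exports.

Local Open Scope classical_set_scope.
Local Open Scope ring_scope.

Local Notation "f ^` ()" := (derive1 f) : ring_scope.

(** The time derivative of [\int u phi] along the flow contains the quadratic
    term [2^-1 * \int u^2 phi_x], while all the other terms are linear in [u].
    Let [N] be large and test the equation on a window [|t - N| <= L] against
      [phi = bump ((t - N) / L) * f ((x + s1 N^m) / N^b) * g ((y + s2 N^n) / N^(b r))]
    with [f' >= c > 0] near [0] and [f' >= - k] everywhere, [k] being small
    compared with the putative lower bound of the local mass.  If the mass in
    [Omega t] stayed bounded below, the quadratic term would contribute at least a
    multiple of [L / N^b].  Since the mass is bounded, the linear terms are at most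
    a multiple of the square root [s] of the area [N^(b (1 + r))] of the support:
    the term with [phi_t] contributes [O(s)] and the dispersive terms
    [O(s L (N^(-3 b) + N^(-b - 2 b r)))].  The latter are negligible because
    [3^-1 < r < 3], so that [L <= D s N^b] for a constant [D], and [L = 2 D s N^b]
    gives a contradiction.  This [L] is an admissible choice: [L <= N / 2] is the
    condition on [b], and the conditions on [m] and [n] say that the centre of
    [Omega t] moves by less than the size of [Omega t] during the window. *)

(** * Smooth functions of one variable *)

(** [Cn n] asks for [n] successive derivatives without continuity of the last one; continuity is
    automatic when every [n] is available, as in [smooth1]. *)
Fixpoint Cn {R : realType} (n : nat) (f : R -> R) : Prop :=
  if n is k.+1 then (forall x, derivable f x 1) /\ Cn k f^`() else True.

Definition smooth1 {R : realType} (f : R -> R) := forall n, Cn n f.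

Lemma Cn_pred {R : realType} (n : nat) (f : R -> R) : Cn n.+1 f -> Cn n f.
Proof.
elim: n f => [//|n IH] f [df Df]; split => //.
exact: IH.
Qed.

Lemma smooth1_derivable {R : realType} (f : R -> R) (x : R) :
  smooth1 f -> derivable f x 1.
Proof. by move=> /(_ 1%N)[]. Qed.

Lemma smooth1_derive1 {R : realType} (f : R -> R) :
  smooth1 f -> smooth1 f^`().
Proof. by move=> fs n; have [] := fs n.+1. Qed.

Lemma smooth1_continuous {R : realType} (f : R -> R) :
  smooth1 f -> continuous f.
Proof.
move=> fs x; apply/differentiable_continuous/derivable1_diffP.
exact: smooth1_derivable.
Qed.

Lemma smooth1_is_derive {R : realType} (f : R -> R) (x : R) :
  smooth1 f -> is_derive x (1 : R) f (f^`() x).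
Proof. by move=> fs; rewrite derive1E; apply/derivableP/smooth1_derivable. Qed.

Lemma derive1_is_derive {R : realType} (f g : R -> R) :
  (forall x, is_derive x (1 : R) f (g x)) -> f^`() = g.
Proof.
by move=> fg; apply/funext => x; rewrite derive1E; have [_ ->] := fg x.
Qed.

Lemma is_deriveM_real {R : realType} (f g : R -> R) (x df dg : R) :
  is_derive x (1 : R) f df -> is_derive x (1 : R) g dg ->
  is_derive x (1 : R) (fun y => f y * g y) (df * g x + f x * dg).
Proof.
move=> fx gx; apply: is_derive_eq.
by rewrite /GRing.scale /=; ring.
Qed.

Lemma derive1M_real {R : realType} (f g : R -> R) :
  (forall x, derivable f x 1) -> (forall x, derivable g x 1) ->
  (fun x => f x * g x)^`() = (fun x => f^`() x * g x + f x * g^`() x).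
Proof.
move=> df dg; apply: derive1_is_derive => x; apply: is_deriveM_real;
  by rewrite derive1E; apply/derivableP.
Qed.

Lemma Cn_add {R : realType} n (f g : R -> R) :
  Cn n f -> Cn n g -> Cn n (fun x => f x + g x).
Proof.
elim: n f g => [//|n IH] f g [df Df] [dg Dg]; split => [x|].
  exact: derivableD.
rewrite (_ : _^`() = (fun x => f^`() x + g^`() x)); first exact: IH.
apply: derive1_is_derive => x; apply: is_deriveD;
  by rewrite derive1E; apply/derivableP.
Qed.

Lemma Cn_mul {R : realType} n (f g : R -> R) :
  Cn n f -> Cn n g -> Cn n (fun x => f x * g x).
Proof.
elim: n f g => [//|n IH] f g fn gn; have [df Df] := fn; have [dg Dg] := gn.
split => [x|]; first exact: derivableM.
by rewrite derive1M_real//; apply: Cn_add; apply: IH => //; apply: Cn_pred.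
Qed.

Lemma smooth1M {R : realType} (f g : R -> R) :
  smooth1 f -> smooth1 g -> smooth1 (fun x => f x * g x).
Proof. by move=> fs gs n; apply: Cn_mul. Qed.

Lemma Cn_cst {R : realType} n (c : R) : Cn n (fun=> c).
Proof.
elim: n c => [//|n IH] c; split=> [x|]; first exact: derivable_cst.
rewrite (_ : _^`() = fun=> 0); first exact: IH.
by apply: derive1_is_derive => x; exact: is_derive_cst.
Qed.

Lemma smooth1_cst {R : realType} (c : R) : smooth1 (fun=> c).
Proof. by move=> n; exact: Cn_cst. Qed.

Lemma is_derive_affine {R : realType} (f : R -> R) (k c x df : R) :
  is_derive (k * x + c) (1 : R) f df ->
  is_derive x (1 : R) (fun y => f (k * y + c)) (k * df).
Proof.
move=> fx.
have gx : is_derive x (1 : R) (fun y => k * y + c) k.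
  by apply: is_derive_eq; rewrite /GRing.scale /= mulr1 addr0.
by rewrite mulrC; exact: (@is_derive1_comp _ f (fun y => k * y + c) x df k fx gx).
Qed.

Lemma derive1_affine {R : realType} (f : R -> R) (k c : R) :
  (forall x, derivable f x 1) ->
  (fun y => f (k * y + c))^`() = (fun y => k * f^`() (k * y + c)).
Proof.
move=> df; apply: derive1_is_derive => x; apply: is_derive_affine.
by rewrite derive1E; apply/derivableP.
Qed.

Lemma smooth1_affine {R : realType} (f : R -> R) (k c : R) :
  smooth1 f -> smooth1 (fun y => f (k * y + c)).
Proof.
move=> fs n; elim: n f fs => [//|n IH] f fs; split => [x|].
  have [//] := @is_derive_affine _ f k c x _ (smooth1_is_derive f (k * x + c) fs).
rewrite derive1_affine; last by move=> x; apply: smooth1_derivable.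
apply: Cn_mul; first exact: Cn_cst.
exact/IH/smooth1_derive1.
Qed.

(** * The flat function [exp (- 1 / x)] *)

(** The difference quotient at [0] is at most [C |h|] in size. This handles the gluing point of
    [flat]. *)
Lemma is_derive0_quadratic {R : realType} (f : R -> R) (C : R) :
  (forall h, `|f h| <= C * h ^+ 2) -> is_derive (0 : R) (1 : R) f 0.
Proof.
move=> fC.
have f0 : f 0 = 0.
  by apply/normr0_eq0/le_anti; rewrite normr_ge0 andbT (le_trans (fC 0))// expr0n mulr0.
have C0 : 0 <= C.
  by have := fC 1; rewrite expr1n mulr1; apply: le_trans.
have lim0 : (h^-1 *: (f (h *: (1 : R) + 0) - f 0)) @[h --> (0 : R)^'] --> (0 : R).
  apply/cvgr0Pnorm_lt => /= e e0.
  near=> h.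
  rewrite f0 subr0 addr0 /GRing.scale /= mulr1 normrM normfV.
  have h0 : 0 < `|h|.
    by rewrite normr_gt0; near: h; exact: nbhs_dnbhs_neq.
  rewrite ltr_pdivrMl// (le_lt_trans (fC h))//.
  rewrite -(real_normK (num_real h)) expr2 mulrA mulrC.
  (* [C + 1] is positive even if [C = 0], so it can be divided by. *)
  rewrite ltr_pM2l// (@le_lt_trans _ _ ((C + 1) * `|h|))//.
    by rewrite ler_wpM2r// lerDl.
  rewrite mulrC -ltr_pdivlMr; last by rewrite ltr_wpDl.
  near: h; by apply: dnbhs0_lt; apply: divr_gt0; rewrite ?ltr_wpDl.
by split; [apply/cvg_ex; exists 0 | rewrite /derive; apply: cvg_lim].
Unshelve. all: by end_near.
Qed.

(** A polynomial in [1 / x] is allowed in front of [exp (- 1 / x)] because this family, unlike the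
    single function, is closed under differentiation. *)
Definition flat {R : realType} (p : {poly R}) (x : R) : R :=
  if 0 < x then p.[x^-1] * expR (- x^-1) else 0.

(** With [y = 1 / x], the series gives [exp y >= y^(i+2) / (i+2)!], hence
    [y^i exp (- y) <= (i+2)! x^2] for each monomial. *)
Lemma flat_bound {R : realType} (p : {poly R}) :
  exists C : R, forall x, `|flat p x| <= C * x ^+ 2.
Proof.
exists (\sum_(i < size p) `|p`_i| * (i.+2)`!%:R) => x; rewrite /flat.
have C0 : 0 <= \sum_(i < size p) `|p`_i| * (i.+2)`!%:R.
  by apply: sumr_ge0 => i _; rewrite mulr_ge0.
case: ifPn => [x0|_]; last by rewrite normr0 mulr_ge0// sqr_ge0.
have y0 : 0 < x^-1 by rewrite invr_gt0.
rewrite horner_coef mulr_suml mulr_suml.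
apply: le_trans (ler_norm_sum _ _ _) _; apply: ler_sum => i _.
rewrite -mulrA normrM -mulrA ler_wpM2l// ger0_norm; last first.
  by rewrite mulr_ge0 ?expR_ge0// exprn_ge0// ltW.
have H : x^-1 ^+ i.+2 / (i.+2)`!%:R <= expR x^-1.
  by apply: le_trans (@expR_ge1Dxn R x^-1 i.+1 (ltW y0)); rewrite lerDr.
rewrite expRN ler_pdivrMr ?expR_gt0//.
have f0 : 0 < (i.+2)`!%:R :> R by rewrite ltr0n fact_gt0.
rewrite ler_pdivrMr// in H.
have -> : x^-1 ^+ i = x ^+ 2 * x^-1 ^+ i.+2.
  by rewrite -[i.+2]addn2 exprD mulrCA -exprMn divff ?gt_eqF// expr1n mulr1.
rewrite [X in _ <= X * _]mulrC -[X in _ <= X]mulrA ler_wpM2l ?sqr_ge0//.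
by rewrite mulrC.
Qed.

(** For [x > 0] and [y = 1 / x], [d/dx = - y^2 d/dy] and [(p exp (- y))' = (p' - p) exp (- y)]; at
    [x = 0] the quadratic bound gives the derivative [0]. *)
Lemma flat_is_derive {R : realType} (p : {poly R}) (x : R) :
  is_derive x (1 : R) (flat p) (flat ('X^2 * (p - deriv p)) x).
Proof.
have [x0|x0|->] := ltgtP x 0.
- have -> : flat ('X^2 * (p - deriv p)) x = 0 by rewrite /flat ltNge (ltW x0).
  apply: (@near_eq_is_derive _ _ _ (cst 0)).
  near=> y; rewrite /flat /cst ltNge ifF//; apply/negbF/ltW.
    near: y; exact: lt_nbhsl.
- pose g (y : R) := p.[y^-1] * expR (- y^-1).
  suff gx : is_derive x (1 : R) g (flat ('X^2 * (p - deriv p)) x).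
    apply: (@near_eq_is_derive _ _ _ g _ x 1 _ _ gx).
    by near=> y; rewrite /flat ifT//; near: y; exact: lt_nbhsr.
  have iV : is_derive x (1 : R) (fun y => y^-1) (- x ^- 2).
    have xn0 : x != 0 by rewrite gt_eqF.
    apply: DeriveDef; first exact: derivableV.
    by rewrite deriveV// derive_id /GRing.scale /= mulr1.
  have iN : is_derive x (1 : R) (fun y => - y^-1) (x ^- 2).
    by apply: is_derive_eq; rewrite opprK.
  have iE : is_derive x (1 : R) (fun y => expR (- y^-1)) (expR (- x^-1) * x ^- 2).
    exact: (@is_derive1_comp _ expR (fun y => - y^-1)).
  have iP : is_derive x (1 : R) (fun y => p.[y^-1]) ((deriv p).[x^-1] * - x ^- 2).
    exact: (@is_derive1_comp _ (horner p) (fun y => y^-1) _ _ _ (is_derive_poly p x^-1) iV).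
  have -> : flat ('X^2 * (p - deriv p)) x =
     (deriv p).[x^-1] * (- x ^- 2) * expR (- x^-1) + p.[x^-1] * (expR (- x^-1) * x ^- 2).
    rewrite /flat x0 hornerM hornerXn hornerD hornerN -!exprVn.
    by ring.
  exact: is_deriveM_real.
- rewrite [X in is_derive _ _ _ X]/flat ltxx.
  by have [C fC] := flat_bound p; apply: is_derive0_quadratic fC.
Unshelve. all: by end_near.
Qed.

Lemma flat_derive1 {R : realType} (p : {poly R}) :
  (flat p)^`() = flat ('X^2 * (p - deriv p)).
Proof. by apply: derive1_is_derive => x; exact: flat_is_derive. Qed.

Lemma flat_smooth1 {R : realType} (p : {poly R}) : smooth1 (flat p).
Proof.
move=> n; elim: n p => [//|n IH] p; split=> [x|]; last by rewrite flat_derive1.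
by have [] := flat_is_derive p x.
Qed.

(** * Profiles *)

(** The condition [A < |x|] is open, so [f] vanishes near each such point and the property passes to
    all derivatives with the same [A]. *)
Lemma supp_derive1 {R : realType} (A : R) (f : R -> R) :
  (forall x, A < `|x| -> f x = 0) -> forall x, A < `|x| -> f^`() x = 0.
Proof.
move=> f0 x Ax; rewrite derive1E.
have f0x : is_derive x (1 : R) f 0.
  have cx : is_derive x (1 : R) (cst 0 : R -> R) 0 by exact: is_derive_cst.
  apply: (@near_eq_is_derive _ _ _ (cst 0) _ x 1 _ _ cx).
  near=> y; rewrite f0//.
  near: y; have /cvgr_gt := @norm_continuous _ R x.
  by move=> /(_ _ Ax); apply.
by have [_ ->] := f0x.
Unshelve. all: by end_near.
Qed.

Lemma supp_bounded {R : realType} (A : R) (f : R -> R) :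
  smooth1 f -> (forall x, A < `|x| -> f x = 0) ->
  exists2 W, 0 < W & forall x, `|f x| <= W.
Proof.
move=> fs f0.
have cf : {within `[- A, A], continuous (fun x => `|f x|)}.
  apply: continuous_subspaceT => x; apply: continuous_comp.
    exact: smooth1_continuous.
  exact: norm_continuous.
have [A0|A0] := leP 0 A; last first.
  by exists 1 => // x; rewrite f0 ?normr0// (lt_le_trans A0).
have [z _ zm] := EVT_max (ge0_cp A0).2 cf.
exists (`|f z| + 1); first by rewrite ltr_wpDl.
move=> x; have [xA|xA] := leP `|x| A.
  apply: le_trans (zm x _) _; last by rewrite lerDl.
  by rewrite in_itv/= -ler_norml.
by rewrite f0// normr0 addr_ge0.
Qed.

Lemma continuous_gt0_min {R : realType} (f : R -> R) (a b : R) :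
  a <= b -> continuous f -> (forall x, a <= x <= b -> 0 < f x) ->
  exists2 c, 0 < c & forall x, a <= x <= b -> c <= f x.
Proof.
move=> ab cf f0.
have cw : {within `[a, b], continuous f} by exact: continuous_subspaceT.
have [z zab zm] := EVT_min ab cw.
exists (f z); first by apply: f0; rewrite in_itv in zab.
by move=> x xab; apply: zm; rewrite in_itv.
Qed.

Lemma flat1E {R : realType} (x : R) :
  flat 1 x = if 0 < x then expR (- x^-1) else 0.
Proof. by rewrite /flat hornerC mul1r. Qed.

Lemma flat1_ge0 {R : realType} (x : R) : 0 <= flat 1 x.
Proof. by rewrite flat1E; case: ifP => // _; exact: expR_ge0. Qed.

Lemma flat1_gt0 {R : realType} (x : R) : 0 < x -> 0 < flat 1 x.
Proof. by rewrite flat1E => ->; exact: expR_gt0. Qed.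

Lemma flat1_le1 {R : realType} (x : R) : flat 1 x <= 1.
Proof.
by rewrite flat1E; case: ifP => // x0; rewrite expR_le1 oppr_le0 invr_ge0 ltW.
Qed.

Lemma flat1_derive1 {R : realType} (x : R) :
  (flat 1)^`() x = if 0 < x then x^-1 ^+ 2 * expR (- x^-1) else 0.
Proof.
by rewrite flat_derive1 derivC subr0 mulr1 /flat hornerXn.
Qed.

(** The first factor vanishes for [x >= 1], the second for [x <= -1]. *)
Definition bump {R : realType} (x : R) : R := flat 1 (1 - x) * flat 1 (1 + x).

Lemma bump_smooth1 {R : realType} : smooth1 (@bump R).
Proof.
have -> : @bump R = (fun x => flat 1 (-1 * x + 1) * flat 1 (1 * x + 1)).
  by apply/funext => x; rewrite /bump mulN1r mul1r addrC [1 + x]addrC.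
by apply: smooth1M; apply: (smooth1_affine (flat 1)); exact: flat_smooth1.
Qed.

Lemma bump_ge0 {R : realType} (x : R) : 0 <= bump x.
Proof. by rewrite mulr_ge0// flat1_ge0. Qed.

Lemma bump_le1 {R : realType} (x : R) : bump x <= 1.
Proof. by rewrite mulr_ile1 ?flat1_ge0// flat1_le1. Qed.

Lemma bump_gt0 {R : realType} (x : R) : `|x| < 1 -> 0 < bump x.
Proof.
rewrite ltr_norml => /andP[x1 x2]; rewrite mulr_gt0// flat1_gt0//; lra.
Qed.

Lemma bump_supp {R : realType} (x : R) : 1 < `|x| -> bump x = 0.
Proof.
rewrite /bump !flat1E lter_normr => /orP[x1|x1].
  by rewrite ifF ?mul0r//; apply/negbTE; rewrite -leNgt; lra.
by rewrite [X in _ * X]ifF ?mulr0//; apply/negbTE; rewrite -leNgt; lra.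
Qed.

Lemma bump_lower {R : realType} :
  exists2 c : R, 0 < c & forall x, `|x| <= 2^-1 -> c <= bump x.
Proof.
have [| |x|c c0 cb] := @continuous_gt0_min R bump (- 2^-1) 2^-1.
- lra.
- exact/smooth1_continuous/bump_smooth1.
- move=> x1; apply: bump_gt0; apply: (@le_lt_trans _ _ 2^-1); last lra.
  by rewrite ler_norml.
- by exists c => // x; rewrite ler_norml => /cb.
Qed.

Lemma smooth1_scale {R : realType} (f : R -> R) (k : R) :
  smooth1 f -> smooth1 (fun x => f (k * x)).
Proof.
move=> fs; rewrite (_ : (fun x => _) = (fun x => f (k * x + 0))).
  exact: smooth1_affine.
by apply/funext => x; rewrite addr0.
Qed.

Lemma derive1_scale {R : realType} (f : R -> R) (k : R) :
  smooth1 f -> (fun x => f (k * x))^`() = (fun x => k * f^`() (k * x)).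
Proof.
move=> fs; rewrite (_ : (fun x => f _) = (fun x => f (k * x + 0))).
  rewrite derive1_affine; last by move=> x; apply: smooth1_derivable.
  by apply/funext => x; rewrite addr0.
by apply/funext => x; rewrite addr0.
Qed.

(* An increasing bounded function times a cut-off at the scale [A]: the cut-off
   makes the derivative negative somewhere, but only by [O(1 / A)]. *)
Lemma almost_increasing_profile {R : realType} :
  exists2 c : R, 0 < c & forall k : R, 0 < k -> exists (A : R) (f : R -> R),
    [/\ 6 <= A, smooth1 f, forall x, A < `|x| -> f x = 0,
        forall x, `|x| <= 3 -> c <= f^`() x &
        forall x, - k <= f^`() x].
Proof.
have [c0 c0_gt0 c0P] := @bump_lower R.
(* [[1, 7]] is the range of [x + 4] for [|x| <= 3]. *)
have [| |x|d d_gt0 dP] := @continuous_gt0_min R (flat 1)^`() 1 7.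
- lra.
- exact/smooth1_continuous/smooth1_derive1/flat_smooth1.
- move=> /andP[x1 _]; have x0 : 0 < x by lra.
  by rewrite flat1_derive1 x0 mulr_gt0 ?expR_gt0// exprn_gt0// invr_gt0.
have [C C_gt0 CP] := @supp_bounded R 1 _ (smooth1_derive1 _ bump_smooth1)
   (supp_derive1 _ _ bump_supp).
have e0 : 0 < d * c0 / 2 by rewrite divr_gt0// mulr_gt0.
exists (d * c0 / 2) => // k k0.
(* The summand [6] puts [x / A] in [[-1/2, 1/2]] for [|x| <= 3]; the other two make the cut-off
   term, of size [C / A], at most [k] and at most half of [d c0]. *)
pose A := 6 + C / k + C / (d * c0 / 2).
have Ck : 0 <= C / k by rewrite divr_ge0 ?ltW.
have Ce : 0 <= C / (d * c0 / 2) by rewrite divr_ge0 ?ltW.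
have A6 : 6 <= A by rewrite /A -addrA lerDl addr_ge0.
have A0 : 0 < A by lra.
have A'0 : 0 < A^-1 by rewrite invr_gt0.
have CA (h : R) : 0 < h -> C / h <= A -> A^-1 * C <= h.
  by move=> h0 hA; rewrite mulrC ler_pdivrMr// mulrC -ler_pdivrMr.
pose f (x : R) := flat 1 (1 * x + 4) * bump (A^-1 * x).
have s1 : smooth1 (fun x : R => flat 1 (1 * x + 4)).
  by apply: (smooth1_affine (flat 1)); exact: flat_smooth1.
have s2 : smooth1 (fun x : R => bump (A^-1 * x)).
  by apply: smooth1_scale; exact: bump_smooth1.
have f'E : f^`() = fun x => (flat 1)^`() (x + 4) * bump (A^-1 * x) +
     flat 1 (x + 4) * (A^-1 * bump^`() (A^-1 * x)).
  rewrite /f derive1M_real; try by move=> x; apply: smooth1_derivable.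
  rewrite derive1_scale; last exact: bump_smooth1.
  rewrite derive1_affine; last by move=> x; apply/smooth1_derivable/flat_smooth1.
  by apply/funext => x; rewrite !mul1r.
have low x : - (A^-1 * C) <= flat 1 (x + 4) * (A^-1 * bump^`() (A^-1 * x)).
  have : `|flat 1 (x + 4) * (A^-1 * bump^`() (A^-1 * x))| <= A^-1 * C.
    rewrite normrM ger0_norm ?flat1_ge0// -[leRHS]mul1r ler_pM ?flat1_ge0 ?flat1_le1//.
    by rewrite normrM (gtr0_norm A'0) ler_wpM2l// ltW.
  by rewrite ler_norml => /andP[].
exists A, f; split => //.
- exact: smooth1M.
- move=> x Ax; rewrite /f bump_supp ?mulr0//.
  by rewrite normrM gtr0_norm ?invr_gt0// mulrC ltr_pdivlMr// mul1r.
- move=> x; rewrite ler_norml => /andP[x1 x2]; rewrite f'E.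
  have h1 : d <= (flat 1)^`() (x + 4) by apply: dP; apply/andP; split; lra.
  have h2 : c0 <= bump (A^-1 * x).
    apply: c0P; rewrite normrM gtr0_norm ?invr_gt0// mulrC ler_pdivrMr//.
    by rewrite ler_norml; apply/andP; split; lra.
  have h3 : d * c0 <= (flat 1)^`() (x + 4) * bump (A^-1 * x).
    by rewrite ler_pM// ltW.
  have h4 : A^-1 * C <= d * c0 / 2 by apply: CA => //; rewrite /A; lra.
  have := low x; lra.
- move=> x; rewrite f'E.
  have h3 : 0 <= (flat 1)^`() (x + 4) * bump (A^-1 * x).
    rewrite mulr_ge0 ?bump_ge0// flat1_derive1; case: ifP => // _.
    by rewrite mulr_ge0 ?expR_ge0// sqr_ge0.
  have h4 : A^-1 * C <= k by apply: CA => //; rewrite /A; lra.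
  have := low x; lra.
Qed.

(** * Tensor products as test functions *)

Definition tensor {R : realType} (a f g : R -> R) : spacetime R -> R :=
  fun z => a z.1 * f z.2.1 * g z.2.2.

(** Along the line [h *: v + z] the function is [f] composed with an affine map of [h], so the
    one-variable chain rule applies. *)
Lemma is_derive_comp_linear {R : realType} (V : normedModType R) (l : V -> R)
    (f : R -> R) (z v : V) :
  (forall h : R, l (h *: v + z) = l v * h + l z) -> smooth1 f ->
  is_derive z v (fun w => f (l w)) (l v * f^`() (l z)).
Proof.
move=> ll fs.
have l0 : f (l z) = f (l v * 0 + l z) by rewrite mulr0 add0r.
have [] := @is_derive_affine R f (l v) (l z) 0 (f^`() (l z)).
  by rewrite mulr0 add0r; exact: smooth1_is_derive.
rewrite /derivable /derive /=.
have -> : (fun h : R => h^-1 *: (f (l v * (h *: (1 : R) + 0) + l z) -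
    f (l v * 0 + l z))) = (fun h : R => h^-1 *: (f (l (h *: v + z)) - f (l z))).
  by apply/funext => h; rewrite ll -l0 addr0 /GRing.scale /= mulr1.
by move=> h1 h2; split.
Qed.

Lemma is_derive_tensor {R : realType} (a f g : R -> R) (z v : spacetime R) :
  smooth1 a -> smooth1 f -> smooth1 g ->
  is_derive z v (tensor a f g) (v.1 * tensor a^`() f g z +
    v.2.1 * tensor a f^`() g z + v.2.2 * tensor a f g^`() z).
Proof.
move=> sa sf sg.
have d1 := @is_derive_comp_linear R (spacetime R) (fun w => w.1) a z v
  (fun h => congr1 (fun x => x + z.1) (mulrC h v.1)) sa.
have d2 := @is_derive_comp_linear R (spacetime R) (fun w => w.2.1) f z v
  (fun h => congr1 (fun x => x + z.2.1) (mulrC h v.2.1)) sf.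
have d3 := @is_derive_comp_linear R (spacetime R) (fun w => w.2.2) g z v
  (fun h => congr1 (fun x => x + z.2.2) (mulrC h v.2.2)) sg.
have d12 := @is_deriveM R (spacetime R) _ _ _ _ _ _ d1 d2.
have d123 := @is_deriveM R (spacetime R) _ _ _ _ _ _ d12 d3.
rewrite /tensor; apply: is_derive_eq d123 _.
by rewrite /GRing.scale /= /GRing.mul /= -!/(GRing.mul _ _); ring.
Qed.

Lemma derive_tensor {R : realType} (a f g : R -> R) (v : spacetime R) :
  smooth1 a -> smooth1 f -> smooth1 g ->
  'D_v (tensor a f g) = (fun z => v.1 * tensor a^`() f g z +
    v.2.1 * tensor a f^`() g z + v.2.2 * tensor a f g^`() z).
Proof.
by move=> sa sf sg; apply/funext => z; have [_ ->] := is_derive_tensor a f g z v sa sf sg.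
Qed.

(** A derivative of a tensor is a sum of three tensors; closing under sums and multiples gives a
    class stable under every ['D_v], so that smoothness follows by induction on the list of
    directions. *)
Inductive tensor_span {R : realType} : (spacetime R -> R) -> Prop :=
| tensor_span_gen a f g : smooth1 a -> smooth1 f -> smooth1 g ->
    tensor_span (tensor a f g)
| tensor_spanD h k : tensor_span h -> tensor_span k ->
    tensor_span (fun z => h z + k z)
| tensor_spanZ (c : R) h : tensor_span h -> tensor_span (fun z => c * h z).

Lemma tensor_continuous {R : realType} (a f g : R -> R) :
  continuous a -> continuous f -> continuous g -> continuous (tensor a f g).
Proof.
move=> ca cf cg z.
have c1 : (w.1 @[w --> z]) --> z.1 by exact: cvg_fst.
have c2 : (w.2 @[w --> z]) --> z.2 by exact: cvg_snd.
apply: cvgM; first apply: cvgM.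
- by apply: (@continuous_comp _ _ _ (fun w : spacetime R => w.1) a z c1); exact: ca.
- apply: (@continuous_comp _ _ _ (fun w : spacetime R => w.2.1) f z).
    by apply: (@continuous_comp _ _ _ (fun w : spacetime R => w.2) fst z c2); exact: cvg_fst.
  exact: cf.
- apply: (@continuous_comp _ _ _ (fun w : spacetime R => w.2.2) g z).
    by apply: (@continuous_comp _ _ _ (fun w : spacetime R => w.2) snd z c2); exact: cvg_snd.
  exact: cg.
Qed.

Lemma tensor_span_derive {R : realType} (h : spacetime R -> R) : tensor_span h ->
  [/\ continuous h, forall z v, derivable h z v &
      forall v, tensor_span ('D_v h)].
Proof.
elim=> {h} [a f g sa sf sg|h k _ [ch dh sh] _ [ck dk sk]|c h _ [ch dh sh]].
- split=> [|z v|v].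
  + by apply: tensor_continuous; exact: smooth1_continuous.
  + by have [] := is_derive_tensor a f g z v sa sf sg.
  + rewrite derive_tensor//; do ![apply: tensor_spanD]; apply: tensor_spanZ;
    by apply: tensor_span_gen => //; exact: smooth1_derive1.
- split=> [z|z v|v].
  + by apply: cvgD; [exact: ch|exact: ck].
  + exact: derivableD.
  + rewrite (_ : 'D_v _ = fun z => 'D_v h z + 'D_v k z).
      by apply: tensor_spanD.
    by apply/funext => z; rewrite -deriveD.
- split=> [z|z v|v].
  + by apply: cvgM; [exact: cvg_cst|exact: ch].
  + exact: derivableZ.
  + rewrite (_ : 'D_v _ = fun z => c * 'D_v h z).
      exact: tensor_spanZ.
    by apply/funext => z; rewrite -[RHS](deriveZ c (dh z v)).
Qed.

Lemma tensor_span_smooth {R : realType} (h : spacetime R -> R) :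
  tensor_span h -> smooth h.
Proof.
move=> sh vs /=.
have : tensor_span (foldr (fun v k => 'D_v k) h vs).
  by elim: vs => [//|v vs IH] /=; have [_ _] := tensor_span_derive _ IH.
by case/tensor_span_derive.
Qed.

(** The nonzero set lies in a box that is compact, hence closed, so the box also contains the
    closure of this set. *)
Lemma tensor_test_function {R : realType} (a f g : R -> R)
    (a0 a1 f0 f1 g0 g1 : R) :
  smooth1 a -> smooth1 f -> smooth1 g ->
  (forall x, ~~ (a0 <= x <= a1) -> a x = 0) ->
  (forall x, ~~ (f0 <= x <= f1) -> f x = 0) ->
  (forall x, ~~ (g0 <= x <= g1) -> g x = 0) ->
  test_function (tensor a f g).
Proof.
move=> sa sf sg a00 f00 g00; split.
  by apply/tensor_span_smooth/tensor_span_gen.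
pose K : set (spacetime R) := `[a0, a1] `*` (`[f0, f1] `*` `[g0, g1]).
have cK : compact K.
  by apply: compact_setX; [|apply: compact_setX]; exact: segment_compact.
apply: (subclosed_compact _ cK); first exact: closed_closure.
have clK : closed K.
  by apply: compact_closed cK; exact: norm_hausdorff.
rewrite closureE; apply: smallest_sub => // z /=; rewrite /tensor => nz.
split; last split; rewrite /= in_itv /=; apply/negPn/negP => h; move/eqP: nz; apply.
- by rewrite a00 ?mul0r.
- by rewrite f00 ?mulr0 ?mul0r.
- by rewrite g00 ?mulr0.
Qed.

Lemma Dt_tensor {R : realType} (a f g : R -> R) :
  smooth1 a -> smooth1 f -> smooth1 g ->
  Dt (tensor a f g) = tensor a^`() f g.
Proof.
move=> sa sf sg; apply/funext => z.
have [_] := is_derive_tensor a f g z (1, (0, 0)) sa sf sg.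
by rewrite /= mul1r !mul0r !addr0.
Qed.

Lemma Dx_tensor {R : realType} (a f g : R -> R) :
  smooth1 a -> smooth1 f -> smooth1 g ->
  Dx (tensor a f g) = tensor a f^`() g.
Proof.
move=> sa sf sg; apply/funext => z.
have [_] := is_derive_tensor a f g z (0, (1, 0)) sa sf sg.
by rewrite /= mul1r !mul0r addr0 add0r.
Qed.

Lemma Dy_tensor {R : realType} (a f g : R -> R) :
  smooth1 a -> smooth1 f -> smooth1 g ->
  Dy (tensor a f g) = tensor a f g^`().
Proof.
move=> sa sf sg; apply/funext => z.
have [_] := is_derive_tensor a f g z (0, (0, 1)) sa sf sg.
by rewrite /= mul1r !mul0r !add0r.
Qed.

Lemma Dx_laplacian_tensor {R : realType} (a f g : R -> R) :
  smooth1 a -> smooth1 f -> smooth1 g ->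
  Dx (laplacian (tensor a f g)) =
  fun z => tensor a f^`()^`()^`() g z + tensor a f^`() g^`()^`() z.
Proof.
move=> sa sf sg.
have := smooth1_derive1 f sf; have := smooth1_derive1 g sg => sg' sf'.
have := smooth1_derive1 _ sf'; have := smooth1_derive1 _ sg' => sg'' sf''.
rewrite /laplacian Dx_tensor// Dy_tensor// Dx_tensor// Dy_tensor//.
apply/funext => z; rewrite /Dx deriveD; last 2 first.
- by have [] := is_derive_tensor a f^`()^`() g z (0, (1, 0)) sa sf'' sg.
- by have [] := is_derive_tensor a f g^`()^`() z (0, (1, 0)) sa sf sg''.
exact: (f_equal2 +%R (congr1 (fun h => h z) (Dx_tensor a _ g sa sf'' sg))
  (congr1 (fun h => h z) (Dx_tensor a f _ sa sf sg''))).
Qed.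

(** * Integral estimates *)

(** The integral of a nonnegative function is the supremum over the simple functions below it, and
    raising the function enlarges that family. *)
Lemma le_integral_nonmeasurable d (T : measurableType d) (R : realType)
    (mu : {measure set T -> \bar R}) (f g : T -> \bar R) :
  (forall x, 0 <= f x)%E -> (forall x, f x <= g x)%E ->
  (\int[mu]_x f x <= \int[mu]_x g x)%E.
Proof.
move=> f0 fg; rewrite !ge0_integralTE//; last by move=> x; exact: le_trans (fg x).
apply: le_ereal_sup => _ [h hf <-]; exists h => //= x.
exact: le_trans (hf x) (fg x).
Qed.

(** [F] may fail to be measurable, so its positive and negative parts are compared by monotonicity.
    The majorant [H] keeps the integral of [F^+] finite; otherwise [fine] could send an infinite
    integral to [0] and break the inequality. *)
Lemma Rintegral_sandwich d (T : measurableType d) (R : realType)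
    (mu : {measure set T -> \bar R}) (G F H : T -> R) :
  mu.-integrable setT (EFin \o G) -> mu.-integrable setT (EFin \o H) ->
  (forall x, G x <= F x) -> (forall x, F x <= H x) ->
  \int[mu]_x G x <= \int[mu]_x F x.
Proof.
move=> iG iH GF FH; rewrite /Rintegral.
have Gf : (\int[mu]_x (G x)%:E \is a fin_num)%E by exact: integrable_fin_num.
have iGn := integrable_funeneg measurableT iG.
have iHp := integrable_funepos measurableT iH.
have Gnf : (\int[mu]_x ((EFin \o G)^\- x) \is a fin_num)%E by exact: integrable_fin_num.
have Hpf : (\int[mu]_x ((EFin \o H)^\+ x) \is a fin_num)%E by exact: integrable_fin_num.
have Fn : (\int[mu]_x ((EFin \o F)^\- x) <= \int[mu]_x ((EFin \o G)^\- x))%E.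
  apply: le_integral_nonmeasurable => x; first by rewrite ?funeposE ?funenegE le_max lexx orbT.
  by rewrite !funenegE /= le_max2// lee_fin lerN2.
have Fp : (\int[mu]_x ((EFin \o F)^\+ x) <= \int[mu]_x ((EFin \o H)^\+ x))%E.
  apply: le_integral_nonmeasurable => x; first by rewrite ?funeposE ?funenegE le_max lexx orbT.
  by rewrite !funeposE /= le_max2// lee_fin.
have GFp : (\int[mu]_x ((EFin \o G)^\+ x) <= \int[mu]_x ((EFin \o F)^\+ x))%E.
  apply: le_integral_nonmeasurable => x; first by rewrite ?funeposE ?funenegE le_max lexx orbT.
  by rewrite !funeposE /= le_max2// lee_fin.
have le_fin (a b : \bar R) : (0 <= a)%E -> (a <= b)%E -> b \is a fin_num -> a \is a fin_num.
  by move=> a0 ab bf; rewrite ge0_fin_numE// (le_lt_trans ab)// ltey_eq bf.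
have Fnf : (\int[mu]_x ((EFin \o F)^\- x) \is a fin_num)%E.
  by apply: le_fin Fn Gnf; apply: integral_ge0.
have Fpf : (\int[mu]_x ((EFin \o F)^\+ x) \is a fin_num)%E.
  by apply: le_fin Fp Hpf; apply: integral_ge0.
have FE : (\int[mu]_x (F x)%:E = \int[mu]_x ((EFin \o F)^\+ x) - \int[mu]_x ((EFin \o F)^\- x))%E.
  exact: integralE.
have GE : (\int[mu]_x (G x)%:E = \int[mu]_x ((EFin \o G)^\+ x) - \int[mu]_x ((EFin \o G)^\- x))%E.
  exact: integralE.
apply: fine_le => //; first by rewrite FE fin_numB Fpf Fnf.
by rewrite FE GE; apply: leeB.
Qed.

Lemma Rintegral_lincomb3 d (T : measurableType d) (R : realType)
    (mu : {measure set T -> \bar R}) (f1 f2 f3 : T -> R) (k1 k2 k3 : R) :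
  mu.-integrable setT (EFin \o f1) -> mu.-integrable setT (EFin \o f2) ->
  mu.-integrable setT (EFin \o f3) ->
  mu.-integrable setT (EFin \o (fun x => k1 * f1 x + k2 * f2 x + k3 * f3 x)) /\
  \int[mu]_x (k1 * f1 x + k2 * f2 x + k3 * f3 x) =
  k1 * \int[mu]_x f1 x + k2 * \int[mu]_x f2 x + k3 * \int[mu]_x f3 x.
Proof.
move=> i1 i2 i3.
have j (k : R) f : mu.-integrable setT (EFin \o f) ->
    mu.-integrable setT (EFin \o (fun x => k * f x)).
  by move=> jf; apply: (integrableZl measurableT k jf).
have j12 : mu.-integrable setT (EFin \o (fun x => k1 * f1 x + k2 * f2 x)).
  exact: (integrableD measurableT (j k1 _ i1) (j k2 _ i2)).
split; first exact: (integrableD measurableT j12 (j k3 _ i3)).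
by rewrite (RintegralD measurableT j12 (j k3 _ i3)) (RintegralD measurableT (j k1 _ i1) (j k2 _ i2)) !RintegralZl.
Qed.

(* The linear term is handled by [|u w| <= w (s u^2 + 1_B / s) / 2], which avoids
   Hoelder's inequality. *)
Lemma virial_inner_bound d (T : measurableType d) (R : realType)
    (mu : {measure set T -> \bar R}) (u W1 W2 : T -> R) (B O : set T)
    (M V s w c1 k c W : R) :
  measurable_fun setT u -> mu.-integrable setT (EFin \o (fun p => u p ^+ 2)) ->
  \int[mu]_p (u p ^+ 2) <= M ->
  measurable_fun setT W1 -> measurable_fun setT W2 ->
  measurable B -> (mu B <= V%:E)%E -> measurable O ->
  (c%:E <= \int[mu]_(p in O) (u p ^+ 2)%:E)%E ->
  0 < s -> 0 <= w -> 0 <= c1 -> 0 <= k -> 0 <= W ->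
  (forall p, `|W1 p| <= w * \1_B p) ->
  (forall p, c1 * \1_O p - k <= W2 p) -> (forall p, `|W2 p| <= W) ->
  - (2^-1 * w * (s * M + s^-1 * V)) + 2^-1 * (c1 * c - k * M) <=
    \int[mu]_p (u p * W1 p + 2^-1 * u p ^+ 2 * W2 p) <=
  2^-1 * w * (s * M + s^-1 * V) + 2^-1 * W * M.
Proof.
move=> mu_ iu uM mW1 mW2 mB BV mO cO s0 w0 c10 k0 W0 W1B W2l W2u.
have iB : mu.-integrable setT (EFin \o (\1_B : T -> R)).
  apply/integrableP; split; first exact/measurable_EFinP/measurable_indic.
  under eq_integral => p _ do rewrite /= ger0_norm ?indicE//.
  under eq_integral => p _ do rewrite -indicE.
  by rewrite integral_indic// setIT (le_lt_trans BV)// ltry.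
have iO : mu.-integrable setT (EFin \o (fun p => \1_O p * u p ^+ 2)).
  apply: le_integrable iu => //.
    apply/measurable_EFinP; apply: measurable_funM.
      exact: measurable_indic.
    exact: measurable_funX.
  move=> p _ /=; rewrite lee_fin normrM ler_piMl//.
  by rewrite indicE; case: (p \in O); rewrite ?normr1 ?normr0.
have IB : \int[mu]_p (\1_B p : R) <= V.
  rewrite /Rintegral integral_indic// setIT -[leRHS]/(fine V%:E) fine_le//.
  by rewrite ge0_fin_numE// (le_lt_trans BV)// ltry.
have IO : c <= \int[mu]_p (\1_O p * u p ^+ 2).
  have E : (\int[mu]_(p in O) (u p ^+ 2)%:E = \int[mu]_p (\1_O p * u p ^+ 2)%:E)%E.
    rewrite integral_mkcond; apply: eq_integral => p _ /=.
    by rewrite patchE indicE; case: ifP => _; rewrite ?mul1r ?mul0r.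
  rewrite -lee_fin; apply: le_trans cO _; rewrite E /Rintegral fineK//.
  exact: integrable_fin_num iO.
have s'0 : 0 < s^-1 by rewrite invr_gt0.
have amgm p : `|u p * W1 p| <= 2^-1 * w * s * u p ^+ 2 + 2^-1 * w * s^-1 * \1_B p.
  rewrite normrM; apply: (@le_trans _ _ (`|u p| * (w * \1_B p))).
    by rewrite ler_wpM2l.
  have -> : u p ^+ 2 = `|u p| ^+ 2 by rewrite real_normK// num_real.
  (* Expanding this square gives [2 |u| <= s u^2 + 1 / s]. *)
  have : 0 <= s^-1 * (s * `|u p| - 1) ^+ 2 by rewrite mulr_ge0 ?sqr_ge0// ltW.
  rewrite (_ : s^-1 * _ = s * `|u p| ^+ 2 - 2 * `|u p| + s^-1); last first.
    by field; rewrite gt_eqF.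
  move=> h; rewrite indicE; case: (p \in B) => /=; last first.
    by rewrite !mulr0 addr0 !mulr_ge0// ?invr_ge0// ?exprn_ge0// ltW.
  rewrite !mulr1; nra.
have q0 p : 0 <= u p ^+ 2 by exact: sqr_ge0.
have q1 p : 0 <= (\1_O p : R) * u p ^+ 2 by rewrite mulr_ge0// indicE.
(* [EL] integrates the minorant that combines [amgm] with [u^2 / 2] times the lower bound on [W2];
   [EU] integrates the corresponding majorant, with third coefficient [0]. *)
have [iL EL] := Rintegral_lincomb3 d T R mu _ _ _ (- (2^-1 * w * s) - 2^-1 * k)
  (- (2^-1 * w * s^-1)) (2^-1 * c1) iu iB iO.
have [iU EU] := Rintegral_lincomb3 d T R mu _ _ _ (2^-1 * w * s + 2^-1 * W)
  (2^-1 * w * s^-1) 0 iu iB iO.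
have JU p : `|u p * W1 p + 2^-1 * u p ^+ 2 * W2 p| <=
    (2^-1 * w * s + 2^-1 * W) * u p ^+ 2 + 2^-1 * w * s^-1 * \1_B p +
    0 * (\1_O p * u p ^+ 2).
  apply: le_trans (ler_normD _ _) _.
  have h : `|2^-1 * u p ^+ 2 * W2 p| <= 2^-1 * u p ^+ 2 * W.
    by rewrite normrM ger0_norm ?ler_wpM2l// mulr_ge0.
  by have := amgm p; lra.
have JL p : (- (2^-1 * w * s) - 2^-1 * k) * u p ^+ 2 +
    (- (2^-1 * w * s^-1)) * \1_B p + 2^-1 * c1 * (\1_O p * u p ^+ 2) <=
    u p * W1 p + 2^-1 * u p ^+ 2 * W2 p.
  have h : 2^-1 * u p ^+ 2 * (c1 * \1_O p - k) <= 2^-1 * u p ^+ 2 * W2 p.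
    by rewrite ler_wpM2l// mulr_ge0.
  have := amgm p; rewrite ler_norml => /andP[+ _]; lra.
have iJ : mu.-integrable setT (EFin \o (fun p => u p * W1 p + 2^-1 * u p ^+ 2 * W2 p)).
  apply: le_integrable iU => //.
    apply/measurable_EFinP; apply: measurable_funD; first exact: measurable_funM.
    apply: measurable_funM => //; apply: measurable_funM; first exact: measurable_cst.
    exact: measurable_funX.
  by move=> p _ /=; rewrite lee_fin; apply: le_trans (JU p) _; exact: ler_norm.
have M0 : 0 <= M by apply: le_trans uM; apply: Rintegral_ge0.
have X0 : 0 <= \int[mu]_p (u p ^+ 2) by apply: Rintegral_ge0.
have h1 : 0 <= 2^-1 * w * s by rewrite !mulr_ge0// ltW.
have h2 : 0 <= 2^-1 * w * s^-1 by rewrite !mulr_ge0// ltW.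
have g1 := ler_wpM2l h1 uM.
have g2 := ler_wpM2l h2 IB.
have g3 := ler_wpM2l k0 uM.
have g4 := ler_wpM2l c10 IO.
have g5 := ler_wpM2l W0 uM.
apply/andP; split.
  apply: le_trans (le_Rintegral measurableT iL iJ (fun p _ => JL p)).
  by rewrite EL; lra.
have JU' p : u p * W1 p + 2^-1 * u p ^+ 2 * W2 p <= _ := le_trans (ler_norm _) (JU p).
apply: le_trans (le_Rintegral measurableT iJ iU (fun p _ => JU' p)) _.
by rewrite EU; lra.
Qed.

(** * Rescaled profiles, time windows and rectangles *)

Lemma derive1Z_real {R : realType} (k : R) (f : R -> R) :
  smooth1 f -> (fun x => k * f x)^`() = (fun x => k * f^`() x).
Proof.
move=> sf; apply: derive1_is_derive => x.
by have := smooth1_is_derive f x sf => fx; apply: is_derive_eq.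
Qed.

Lemma derive1_affine_smooth1 {R : realType} (f : R -> R) (k c : R) :
  smooth1 f ->
  [/\ (fun y => f (k * y + c))^`() = (fun y => k * f^`() (k * y + c)),
      (fun y => f (k * y + c))^`()^`() =
        (fun y => k ^+ 2 * f^`()^`() (k * y + c)) &
      (fun y => f (k * y + c))^`()^`()^`() =
        (fun y => k ^+ 3 * f^`()^`()^`() (k * y + c))].
Proof.
move=> sf; have sf' := smooth1_derive1 _ sf; have sf'' := smooth1_derive1 _ sf'.
have D h : smooth1 h -> (fun y => h (k * y + c))^`() = (fun y => k * h^`() (k * y + c)).
  by move=> sh; apply: derive1_affine => x; exact: smooth1_derivable.
rewrite (D _ sf) derive1Z_real; last exact: smooth1_affine.
rewrite (D _ sf'); split => //; first by apply/funext => y; rewrite mulrA -expr2.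
rewrite [X in (derive1 X)](_ : _ = fun y => k ^+ 2 * f^`()^`() (k * y + c)).
  apply: etrans (derive1Z_real _ _ (smooth1_affine _ k c sf'')) _.
  apply/funext => y; rewrite [k ^+ 3]exprSr -[RHS]mulrA; congr (_ * _).
  exact: (congr1 (fun h => h y) (D _ sf'')).
by apply/funext => y; rewrite mulrA -expr2.
Qed.

Lemma lebesgue_measure_segment {R : realType} (a b : R) : a <= b ->
  lebesgue_measure (`[a, b]%classic : set R) = (b - a)%:E.
Proof.
rewrite lebesgue_measure_itv /= lte_fin.
by case: ltgtP => // -> _; rewrite subrr.
Qed.

Lemma Rintegral_indic_segment {R : realType} (a b : R) : a <= b ->
  (@lebesgue_measure R).-integrable setT (EFin \o (\1_(`[a, b]%classic) : R -> R)) /\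
  \int[@lebesgue_measure R]_x (\1_(`[a, b]%classic) x : R) = b - a.
Proof.
move=> ab; split; first exact: integrable_indic_itv.
rewrite /Rintegral integral_indic// setIT.
by rewrite [X in fine X](lebesgue_measure_segment _ _ ab).
Qed.

(* Time measurability of the inner integral of a solution is never established:
   the bounds on both sides of [F] stand in for it. *)
Lemma window_integral {R : realType} (F : R -> R) (t0 L q k h : R) :
  0 < L -> 0 <= k -> 0 <= q ->
  (forall t, `|t - t0| <= L -> - q <= F t <= h) ->
  (forall t, `|t - t0| <= L / 2 -> k - q <= F t) ->
  (forall t, L < `|t - t0| -> F t = 0) ->
  \int[@lebesgue_measure R]_t F t = 0 -> k * L <= 2 * q * L.
Proof.
move=> L0 k0 q0 Fb Fk F0 IF.
pose J : set R := `[t0 - L, t0 + L]%classic.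
pose J' : set R := `[t0 - L / 2, t0 + L / 2]%classic.
have [iJ EJ] : (@lebesgue_measure R).-integrable setT (EFin \o (\1_J : R -> R)) /\
    \int[@lebesgue_measure R]_t (\1_J t : R) = (t0 + L) - (t0 - L).
  by apply: Rintegral_indic_segment; lra.
have [iJ' EJ'] : (@lebesgue_measure R).-integrable setT (EFin \o (\1_J' : R -> R)) /\
    \int[@lebesgue_measure R]_t (\1_J' t : R) = (t0 + L / 2) - (t0 - L / 2).
  by apply: Rintegral_indic_segment; lra.
(* The gain [k] holds on the half window [J'] of length [L], the loss [q] on all of [J], of length
   [2 L]: the minorant integrates to [k L - 2 q L]. *)
have [iG EG] := Rintegral_lincomb3 _ _ _ _ _ _ _ (- q) k 0 iJ iJ' iJ.
have [iH _] := Rintegral_lincomb3 _ _ _ _ _ _ _ h 0 0 iJ iJ' iJ.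
have inJ t : (t \in J) = (`|t - t0| <= L).
  apply/idP/idP; rewrite inE /J /= in_itv /= ler_norml => /andP[a b];
  by apply/andP; split; lra.
have inJ' t : (t \in J') = (`|t - t0| <= L / 2).
  apply/idP/idP; rewrite inE /J' /= in_itv /= ler_norml => /andP[a b];
  by apply/andP; split; lra.
have GF t : - q * \1_J t + k * \1_J' t + 0 * \1_J t <= F t.
  rewrite !indicE inJ inJ'.
  have [a|a] := leP `|t - t0| (L / 2).
    by rewrite (_ : _ <= L) /=; [have := Fk _ a; lra|lra].
  have [b|b] := leP `|t - t0| L; last by rewrite F0//=; lra.
  by have /andP[] := Fb _ b; rewrite /=; lra.
have FH t : F t <= h * \1_J t + 0 * \1_J' t + 0 * \1_J t.
  rewrite !indicE inJ; have [b|b] := leP `|t - t0| L; last by rewrite F0//=; lra.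
  by have /andP[] := Fb _ b; rewrite /=; lra.
have := Rintegral_sandwich _ _ _ _ _ _ _ iG iH GF FH.
by rewrite IF EG EJ EJ'; lra.
Qed.

Lemma leb2_rectangle {R : realType} (x0 x1 y0 y1 : R) : x0 <= x1 -> y0 <= y1 ->
  leb2 R (`[x0, x1] `*` `[y0, y1]) = ((x1 - x0) * (y1 - y0))%:E.
Proof.
move=> x01 y01; rewrite /leb2 EFinM.
rewrite -(lebesgue_measure_segment _ _ x01) -(lebesgue_measure_segment _ _ y01).
exact: product_measure1E.
Qed.

Lemma measurable_tensor2 {R : realType} (f g : R -> R) :
  continuous f -> continuous g ->
  measurable_fun setT (fun p : measurableTypeR R * measurableTypeR R => f p.1 * g p.2).
Proof.
move=> cf cg; apply: measurable_funM.
  by apply: measurableT_comp => //; exact: continuous_measurable_fun.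
by apply: measurableT_comp => //; exact: continuous_measurable_fun.
Qed.

(** * The virial estimate *)

(** Since [0 <= G <= 1], multiplying by [G] preserves the lower bound [- k]. [P] stands for
    membership in the set carrying the mass, so that [P%:R] is its indicator. *)
Lemma product_profile_lower {R : realType} (F G c1 c0 k : R) (P : bool) :
  0 <= c1 -> 0 <= k -> 0 <= G <= 1 -> - k <= F ->
  (P -> c1 <= F /\ c0 <= G) -> 0 <= c0 ->
  c1 * c0 * P%:R - k <= F * G.
Proof.
move=> c10 k0 /andP[G0 G1] Fk FP c00.
have FG : - k <= F * G by nra.
case: P FP => /= [/(_ isT)[h1 h2]|_]; last by rewrite mulr0 add0r.
by rewrite mulr1; have := ler_pM c10 c00 h1 h2; lra.
Qed.

(** [D] is fixed before the scales [a], [b], the window [L] and the centre, so all of these may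
    depend on [N]. The smallness condition lets half of the remaining quadratic gain absorb the
    dispersive terms; the other half is compared with the [O(s)] contribution of [phi_t]. *)
Lemma virial_estimate {R : realType} (u : R -> R * R -> R) (M c : R) :
  (forall t, u t \in Lfun (leb2 R) 2%:E) ->
  (forall t, \int[leb2 R]_p (u t p ^+ 2) <= M) ->
  ZK_distributional u -> 0 < c ->
  exists2 D, 0 < D & forall a b s L t0 x0 y0 : R,
    0 < a -> 0 < b -> 0 < s -> s ^+ 2 = a * b -> 0 < L ->
    (forall t, `|t - t0| <= L ->
       exists O : set (measurableTypeR R * measurableTypeR R),
       [/\ measurable O,
         forall p, O p -> `|p.1 - x0| <= 3 * a /\ `|p.2 - y0| <= 3 * b &
         (c%:E <= \int[leb2 R]_(p in O) (u t p ^+ 2)%:E)%E]) ->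
    D * s * (a^-1 ^+ 2 + b^-1 ^+ 2) <= 1 -> L <= D * s * a.
Proof.
(* In each summand the amplitude is followed by a product of three profile values, so that one bound
   [W ^+ 3] serves for all of them. *)
have regroup (l v1 v2 v3 h a3 v4 a1 v5 b2 v6 : R) :
    l * v1 * v2 * v3 + (h * (a3 * v4) * v3 + h * (a1 * v5) * (b2 * v6)) =
    l * (v1 * v2 * v3) + (h * a3) * (v4 * v3 * 1) +
    (h * (a1 * b2)) * (v5 * v6 * 1) by ring.
move=> hL hM hZK c_gt0.
have M0 : 0 <= M by apply: le_trans (hM 0); apply: Rintegral_ge0 => p _; exact: sqr_ge0.
have [c1 c1_gt0 prof] := @almost_increasing_profile R.
have [c0 c0_gt0 c0P] := @bump_lower R.
(* At most half of the gain [c1 c0 c] is lost to the negative part of [f']; [M + 1] avoids a zero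
   denominator. *)
pose k := c1 * c0 * c / (2 * (M + 1)).
have k_gt0 : 0 < k by rewrite divr_gt0 ?mulr_gt0// ltr_wpDl.
have kM : k * M <= c1 * c0 * c / 2.
  rewrite /k mulrAC ler_pdivrMr; last by rewrite mulr_gt0// ltr_wpDl.
  rewrite [leRHS](_ : _ = c1 * c0 * c * (M + 1)); last by field.
  by rewrite ler_wpM2l ?lerDl// ltW// !mulr_gt0.
have [A [f [A6 sf f0 f1 fk]]] := prof k k_gt0.
(* For [|y| <= 3] the argument stays in [[-1/2, 1/2]], where [bump >= c0]; the support [|y| <= 6]
   fits in [|y| <= A]. *)
pose g (y : R) := bump (6^-1 * y).
have sg : smooth1 g by apply: smooth1_scale; exact: bump_smooth1.
have g01 y : 0 <= g y <= 1 by rewrite bump_ge0 bump_le1.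
have g0 y : A < `|y| -> g y = 0.
  move=> Ay; apply: bump_supp; rewrite normrM gtr0_norm ?invr_gt0//.
  by rewrite mulrC ltr_pdivlMr// mul1r (le_lt_trans A6).
have gc0 y : `|y| <= 3 -> c0 <= g y.
  move=> y3; apply: c0P; rewrite normrM gtr0_norm ?invr_gt0//; lra.
have sb := @bump_smooth1 R.
have sf' := smooth1_derive1 _ sf; have sf'' := smooth1_derive1 _ sf'.
have sf''' := smooth1_derive1 _ sf''.
have sg' := smooth1_derive1 _ sg; have sg'' := smooth1_derive1 _ sg'.
have sb' := smooth1_derive1 _ sb.
have f0' := supp_derive1 _ _ f0; have f0'' := supp_derive1 _ _ f0'.
have f0''' := supp_derive1 _ _ f0''.
have g0'' := supp_derive1 _ _ (supp_derive1 _ _ g0).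
have b0' := supp_derive1 _ _ (@bump_supp R).
have [w0 w0_gt0 w0P] := supp_bounded _ _ sf f0.
have [w1 w1_gt0 w1P] := supp_bounded _ _ sf' f0'.
have [w3 w3_gt0 w3P] := supp_bounded _ _ sf''' f0'''.
have [w2 w2_gt0 w2P] := supp_bounded _ _ sg'' g0''.
have [wb wb_gt0 wbP] := supp_bounded _ _ sb' b0'.
pose W := 1 + w0 + w1 + w2 + w3 + wb.
have W_gt0 : 0 < W by rewrite /W; lra.
have W1 : 1 <= W by rewrite /W; lra.
(* [4 A^2 s^2] is the area of the box [B] below, and [s M + s^-1 (4 A^2 s^2) = s K]. [e] is what
   remains of the quadratic gain after the factor [1/2] and the loss to [k]. *)
pose K := M + 4 * A ^+ 2.
pose Q := 2^-1 * W ^+ 3 * K.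
pose e := c1 * c0 * c / 4.
have A_gt0 : 0 < A by lra.
have K_gt0 : 0 < K by rewrite ltr_wpDl// mulr_gt0// exprn_gt0.
have Q_gt0 : 0 < Q by rewrite !mulr_gt0// exprn_gt0.
have e_gt0 : 0 < e by rewrite divr_gt0// !mulr_gt0.
have D1 : 0 < 4 * Q / (e * c0) by rewrite divr_gt0 ?mulr_gt0.
have D2 : 0 < 2 * Q / e by rewrite divr_gt0 ?mulr_gt0.
(* The first summand is the final bound on [L / (s a)]; the second turns the smallness condition
   into [aE]. *)
exists (4 * Q / (e * c0) + 2 * Q / e); first exact: addr_gt0.
move=> a b s L t0 x0 y0 a_gt0 b_gt0 s_gt0 sab L_gt0 hO small.
have a'_gt0 : 0 < a^-1 by rewrite invr_gt0.
have b'_gt0 : 0 < b^-1 by rewrite invr_gt0.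
have L'_gt0 : 0 < L^-1 by rewrite invr_gt0.
(* Up to constants, [E] is the size of [phi_xxx] and [phi_xyy]; it factors as
   [a^-1 (a^-2 + b^-2)]. *)
pose E := a^-1 ^+ 3 + a^-1 * b^-1 ^+ 2.
have E0 : 0 <= E by rewrite addr_ge0// ?mulr_ge0 ?exprn_ge0// ltW.
have aE : Q * s * E <= a^-1 * (e / 2).
  have h : 2 * Q / e * s * (a^-1 ^+ 2 + b^-1 ^+ 2) <= 1.
    apply: le_trans small; rewrite ler_wpM2r ?addr_ge0 ?sqr_ge0//.
    by rewrite ler_wpM2r ?lerDr ?(ltW s_gt0) ?(ltW D1).
  rewrite (_ : Q * s * E = a^-1 * (e / 2) *
     (2 * Q / e * s * (a^-1 ^+ 2 + b^-1 ^+ 2))); last first.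
    by rewrite /E; field; rewrite ?gt_eqF.
  by rewrite ler_piMr// ltW// mulr_gt0// divr_gt0.
pose tau t := L^-1 * t + - (L^-1 * t0).
pose xi x := a^-1 * x + - (a^-1 * x0).
pose eta y := b^-1 * y + - (b^-1 * y0).
have tauE t : tau t = L^-1 * (t - t0) by rewrite /tau mulrBr.
have xiE x : xi x = a^-1 * (x - x0) by rewrite /xi mulrBr.
have etaE y : eta y = b^-1 * (y - y0) by rewrite /eta mulrBr.
have ntau t : `|tau t| = L^-1 * `|t - t0| by rewrite tauE normrM gtr0_norm.
have nxi x : `|xi x| = a^-1 * `|x - x0| by rewrite xiE normrM gtr0_norm.
have neta y : `|eta y| = b^-1 * `|y - y0| by rewrite etaE normrM gtr0_norm.
pose as_ (t : R) := bump (tau t).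
pose fs (x : R) := f (xi x).
pose gs (y : R) := g (eta y).
have sas : smooth1 as_ by exact: smooth1_affine.
have sfs : smooth1 fs by exact: smooth1_affine.
have sgs : smooth1 gs by exact: smooth1_affine.
have [das _ _] := derive1_affine_smooth1 bump L^-1 (- (L^-1 * t0)) sb.
have [dfs _ dfs3] := derive1_affine_smooth1 f a^-1 (- (a^-1 * x0)) sf.
have [_ dgs2 _] := derive1_affine_smooth1 g b^-1 (- (b^-1 * y0)) sg.
have test : test_function (tensor as_ fs gs).
  apply: (@tensor_test_function _ _ _ _ (t0 - L) (t0 + L) (x0 - A * a)
    (x0 + A * a) (y0 - A * b) (y0 + A * b)) => // x; rewrite -ler_distlC.
  - rewrite -ltNge => h; apply: bump_supp; rewrite ntau distrC.
    by rewrite mulrC ltr_pdivlMr// mul1r.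
  - by rewrite -ltNge => h; apply: f0; rewrite nxi distrC mulrC ltr_pdivlMr.
  - by rewrite -ltNge => h; apply: g0; rewrite neta distrC mulrC ltr_pdivlMr.
(* [T1] is [phi_t + d_x (Delta phi)] and [T2] is [phi_x]. *)
pose T1 t (p : R * R) := L^-1 * bump^`() (tau t) * fs p.1 * gs p.2 +
  (bump (tau t) * (a^-1 ^+ 3 * f^`()^`()^`() (xi p.1)) * gs p.2 +
   bump (tau t) * (a^-1 * f^`() (xi p.1)) * (b^-1 ^+ 2 * g^`()^`() (eta p.2))).
pose T2 t (p : R * R) := bump (tau t) * (a^-1 * f^`() (xi p.1)) * gs p.2.
pose F t := \int[leb2 R]_p (u t p * T1 t p + 2^-1 * u t p ^+ 2 * T2 t p).
have IF : \int[@lebesgue_measure R]_t F t = 0.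
  apply: etrans (hZK _ test); apply: eq_Rintegral => t _.
  apply: eq_Rintegral => p _.
  by rewrite Dt_tensor// Dx_laplacian_tensor// Dx_tensor// das dfs3 dgs2 dfs.
have h0 t : 0 <= bump (tau t) <= 1 by rewrite bump_ge0 bump_le1.
(* Only the [phi_t] term loses the factor [bump (tau t)]. The dispersive terms keep it, like the
   quadratic gain, so they can be absorbed at each time, even near the edges of the window where
   both vanish. *)
pose w t := W ^+ 3 * (L^-1 + bump (tau t) * E).
have [W_ge0 L'_ge0 a'_ge0 b'_ge0] : [/\ 0 <= W, 0 <= L^-1, 0 <= a^-1 & 0 <= b^-1].
  by split; exact: ltW.
have [c0_ge0 c1_ge0 k_ge0 s_ge0] : [/\ 0 <= c0, 0 <= c1, 0 <= k & 0 <= s].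
  by split; exact: ltW.
have w_ge0 t : 0 <= w t.
  have /andP[ht0 ht1] := h0 t.
  by rewrite /w mulr_ge0 ?exprn_ge0// addr_ge0// mulr_ge0.
pose B : set (measurableTypeR R * measurableTypeR R) :=
  `[x0 - A * a, x0 + A * a] `*` `[y0 - A * b, y0 + A * b].
have mB : measurable B by apply: measurableX; exact: measurable_itv.
have Aa : 0 < A * a by rewrite mulr_gt0.
have Ab : 0 < A * b by rewrite mulr_gt0.
have muB : (leb2 R B <= (4 * A ^+ 2 * s ^+ 2)%:E)%E.
  rewrite leb2_rectangle; [|by clear -Aa; lra|by clear -Ab; lra].
  by rewrite sab lee_fin le_eqVlt; apply/orP; left; apply/eqP; ring.
have prod3 x y z : `|x| <= W -> `|y| <= W -> `|z| <= W -> `|x * y * z| <= W ^+ 3.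
  by move=> hx hy hz; rewrite !normrM exprSr expr2 !ler_pM// mulr_ge0.
have fW x : `|f x| <= W by apply: le_trans (w0P x) _; rewrite /W;
  clear -w0_gt0 w1_gt0 w2_gt0 w3_gt0 wb_gt0; lra.
have f'W x : `|f^`() x| <= W by apply: le_trans (w1P x) _; rewrite /W;
  clear -w0_gt0 w1_gt0 w2_gt0 w3_gt0 wb_gt0; lra.
have f3W x : `|f^`()^`()^`() x| <= W by apply: le_trans (w3P x) _; rewrite /W;
  clear -w0_gt0 w1_gt0 w2_gt0 w3_gt0 wb_gt0; lra.
have g2W x : `|g^`()^`() x| <= W by apply: le_trans (w2P x) _; rewrite /W;
  clear -w0_gt0 w1_gt0 w2_gt0 w3_gt0 wb_gt0; lra.
have b'W x : `|bump^`() x| <= W by apply: le_trans (wbP x) _; rewrite /W;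
  clear -w0_gt0 w1_gt0 w2_gt0 w3_gt0 wb_gt0; lra.
have gW x : `|g x| <= W.
  by have /andP[h1 h2] := g01 x; rewrite ger0_norm// (le_trans h2).
have W1' : `|1 : R| <= W by rewrite normr1.
have T1B t p : `|T1 t p| <= w t * \1_B p.
  have /andP[ht0 ht1] := h0 t.
  have -> : T1 t p = L^-1 * (bump^`() (tau t) * f (xi p.1) * g (eta p.2)) +
      (bump (tau t) * a^-1 ^+ 3) * (f^`()^`()^`() (xi p.1) * g (eta p.2) * 1) +
      (bump (tau t) * (a^-1 * b^-1 ^+ 2)) *
        (f^`() (xi p.1) * g^`()^`() (eta p.2) * 1).
    exact: regroup.
  have ha : 0 <= bump (tau t) * a^-1 ^+ 3 by rewrite mulr_ge0 ?exprn_ge0.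
  have hb : 0 <= bump (tau t) * (a^-1 * b^-1 ^+ 2).
    by apply: mulr_ge0 => //; rewrite mulr_ge0 ?exprn_ge0.
  have [pB|pB] := boolP (p \in B).
    rewrite indicE pB [w t * _]mulr1 (_ : w t = L^-1 * W ^+ 3 +
      (bump (tau t) * a^-1 ^+ 3) * W ^+ 3 +
      (bump (tau t) * (a^-1 * b^-1 ^+ 2)) * W ^+ 3); last by rewrite /w /E; ring.
    apply: le_trans (ler_normD _ _) _; apply: lerD.
      apply: le_trans (ler_normD _ _) _; apply: lerD.
        by rewrite normrM (ger0_norm L'_ge0) ler_wpM2l// prod3.
      by rewrite normrM (ger0_norm ha) ler_wpM2l// prod3.
    by rewrite normrM (ger0_norm hb) ler_wpM2l// prod3.
  (* Off [B] one of the two rescaled coordinates exceeds [A] in size, where its profile and the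
     derivatives in use vanish. *)
  rewrite indicE (negbTE pB) mulr0.
  have [hx|hx] := ltP A `|xi p.1|.
    by rewrite f0// f0'''// f0'// !(mul0r, mulr0) !addr0 normr0.
  have [hy|hy] := ltP A `|eta p.2|.
    by rewrite g0// g0''// !(mul0r, mulr0) !addr0 normr0.
  exfalso; move/negP: pB; apply; rewrite inE; split; rewrite /= in_itv /= -ler_distl.
    by rewrite -ler_pdivrMr// mulrC -nxi.
  by rewrite -ler_pdivrMr// mulrC -neta.
have T2l t p (O : set (measurableTypeR R * measurableTypeR R)) :
    (forall p, O p -> `|p.1 - x0| <= 3 * a /\ `|p.2 - y0| <= 3 * b) ->
    bump (tau t) * a^-1 * (c1 * c0) * \1_O p - bump (tau t) * a^-1 * k <= T2 t p.
  move=> hOp; have /andP[ht0 ht1] := h0 t.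
  have -> : T2 t p = bump (tau t) * a^-1 * (f^`() (xi p.1) * g (eta p.2)).
    by rewrite /T2 /gs; ring.
  rewrite -[_ * \1_O p]mulrA -mulrBr indicE ler_wpM2l//; first exact: mulr_ge0.
  apply: product_profile_lower => //.
  rewrite inE => /hOp[hx hy]; split.
    by apply: f1; rewrite nxi mulrC ler_pdivrMr.
  by apply: gc0; rewrite neta mulrC ler_pdivrMr.
have T2u t p : `|T2 t p| <= a^-1 * W ^+ 2.
  have /andP[ht0 ht1] := h0 t.
  rewrite /T2 normrM (normrM (bump _)) (normrM a^-1) (ger0_norm ht0) (ger0_norm a'_ge0).
  rewrite (_ : _ * _ * _ = bump (tau t) * (a^-1 * (`|f^`() (xi p.1)| * `|gs p.2|))).
    apply: le_trans (ler_piMl _ ht1) _; first by rewrite mulr_ge0// mulr_ge0.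
    by rewrite ler_wpM2l// expr2 ler_pM// gW.
  by ring.
have mu_ t : measurable_fun setT (u t).
  by have := hL t; rewrite inE => /andP[/[!inE]].
have mT1 t : measurable_fun setT (T1 t : measurableTypeR R * measurableTypeR R -> R).
  have m (j : R) h1 h2 : smooth1 h1 -> smooth1 h2 -> measurable_fun setT
      (fun p : measurableTypeR R * measurableTypeR R => j * h1 p.1 * h2 p.2).
    move=> s1 s2; apply: (measurable_tensor2 (fun x => j * h1 x) h2).
      by apply/smooth1_continuous/smooth1M => //; exact: smooth1_cst.
    exact: smooth1_continuous.
  have sc (j : R) h1 : smooth1 h1 -> smooth1 (fun x => j * h1 x).
    by move=> s1; apply: smooth1M => //; exact: smooth1_cst.
  have sx3 := smooth1_affine _ a^-1 (- (a^-1 * x0)) sf'''.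
  have sx1 := smooth1_affine _ a^-1 (- (a^-1 * x0)) sf'.
  have sy2 := smooth1_affine _ b^-1 (- (b^-1 * y0)) sg''.
  apply: measurable_funD; first exact: (m _ fs gs).
  apply: measurable_funD; first exact: (m _ _ gs (sc _ _ sx3)).
  exact: (m _ _ _ (sc _ _ sx1) (sc _ _ sy2)).
have mT2 t : measurable_fun setT (T2 t : measurableTypeR R * measurableTypeR R -> R).
  apply: (measurable_tensor2 (fun x => bump (tau t) * (a^-1 * f^`() (xi x))) gs).
    apply/smooth1_continuous/smooth1M; first exact: smooth1_cst.
    apply: smooth1M; first exact: smooth1_cst.
    exact: (smooth1_affine _ _ _ sf').
  exact: smooth1_continuous.
have Fb t : `|t - t0| <= L ->
    - (Q * s * L^-1) + bump (tau t) * (a^-1 * (e / 2)) <= F t <=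
    Q * s * (L^-1 + E) + 2^-1 * (a^-1 * W ^+ 2) * M.
  move=> tL; have [U [mU hUp hUc]] := hO t tL.
  have /andP[ht0 ht1] := h0 t.
  have H := @virial_inner_bound _ _ R (leb2 R) (u t) (T1 t) (T2 t) B U M
    (4 * A ^+ 2 * s ^+ 2) s (w t) (bump (tau t) * a^-1 * (c1 * c0))
    (bump (tau t) * a^-1 * k) c (a^-1 * W ^+ 2) (mu_ t)
    (Lfun2_integrable_sqr (hL t)) (hM t) (mT1 t) (mT2 t) mB muB mU hUc s_gt0.
  have sK : s * M + s^-1 * (4 * A ^+ 2 * s ^+ 2) = s * K.
    by rewrite /K; field; rewrite gt_eqF.
  have wK : 2^-1 * w t * (s * K) = Q * s * (L^-1 + bump (tau t) * E).
    by rewrite /w /Q; ring.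
  have W2_ge0 : 0 <= a^-1 * W ^+ 2 by rewrite mulr_ge0 ?exprn_ge0.
  have ba_ge0 := mulr_ge0 ht0 a'_ge0.
  have c1'_ge0 := mulr_ge0 ba_ge0 (mulr_ge0 c1_ge0 c0_ge0).
  have k'_ge0 := mulr_ge0 ba_ge0 k_ge0.
  have {}H := H (w_ge0 t) c1'_ge0 k'_ge0 W2_ge0 (T1B t) (fun p => T2l t p U hUp) (T2u t).
  move: H; rewrite sK wK -/(F t) => /andP[Hl Hu]; apply/andP; split.
    apply: le_trans Hl.
    (* The dispersive loss is absorbed through [aE], the loss to [k] through [kM]. *)
    have h1 : bump (tau t) * (Q * s * E) <= bump (tau t) * (a^-1 * (e / 2)).
      by rewrite ler_wpM2l.
    have h2 : bump (tau t) * a^-1 * (k * M) <= bump (tau t) * a^-1 * (c1 * c0 * c / 2).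
      by rewrite ler_wpM2l.
    by rewrite /e in h1 *; clear -h1 h2; lra.
  apply: le_trans Hu _; rewrite lerD2r ler_wpM2l//; last by rewrite lerD2l ler_piMl.
  by rewrite ltW// mulr_gt0.
have Ls : 0 <= Q * s * L^-1 by rewrite ltW// !mulr_gt0.
have := @window_integral R F t0 L (Q * s * L^-1) (c0 * (a^-1 * (e / 2)))
  (Q * s * (L^-1 + E) + 2^-1 * (a^-1 * W ^+ 2) * M) L_gt0.
have ae : 0 <= a^-1 * (e / 2) by rewrite ltW// mulr_gt0// divr_gt0.
move=> /(_ (mulr_ge0 (ltW c0_gt0) ae) Ls) H.
have {H} : c0 * (a^-1 * (e / 2)) * L <= 2 * (Q * s * L^-1) * L.
  apply: H IF.
  - move=> t /Fb /andP[h1 h2]; rewrite h2 andbT; apply: le_trans h1.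
    by rewrite lerDl mulr_ge0// bump_ge0.
  - move=> t tL; have /Fb /andP[h1 _] : `|t - t0| <= L.
      by clear -tL L_gt0; lra.
    apply: le_trans h1; rewrite addrC lerD2l ler_wpM2r//.
    by apply: c0P; rewrite ntau mulrC ler_pdivrMr//; clear -tL; lra.
  - move=> t tL; have b1 : 1 < `|tau t| by rewrite ntau mulrC ltr_pdivlMr// mul1r.
    rewrite /F /T1 /T2 (bump_supp _ b1) (b0' _ b1).
    under eq_Rintegral => p _.
      rewrite !(mul0r, mulr0, addr0); over.
    by rewrite /Rintegral integral0.
(* The factor [L^-1] coming from [phi_t] cancels the length of the window, leaving an [O(s)]
   bound. *)
rewrite -[2 * _ * L]mulrA mulfVK ?gt_eqF// => HL.
have {}HL : L <= 4 * Q / (e * c0) * s * a.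
  rewrite (_ : 4 * Q / _ * s * a = 2 * (Q * s) / (c0 * (a^-1 * (e / 2)))); last first.
    by field; rewrite ?gt_eqF.
  by rewrite ler_pdivlMr 1?mulrC ?mulr_gt0// divr_gt0.
apply: le_trans HL _; rewrite !ler_pM2r// lerDl ltW//.
Qed.

(** * Asymptotics *)

(** It suffices that [N >= C^(1 / (- p))]. *)
Lemma near_pinfty_powR_le1 {R : realType} (C p : R) : 0 < C -> p < 0 ->
  \forall N \near +oo%R, C * N `^ p <= 1.
Proof.
move=> C0 p0; near=> N.
have N0 : 0 < N by near: N; exact: nbhs_pinfty_gt.
have CN : C `^ ((- p)^-1) <= N by near: N; exact: nbhs_pinfty_ge.
have q0 : 0 < - p by rewrite oppr_gt0.
rewrite -[p]opprK powRN ler_pdivrMr ?powR_gt0// mul1r.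
have qn0 : - p != 0 by rewrite gt_eqF.
rewrite -[leLHS](powRr1 (ltW C0)) -(mulVf qn0) powRrM.
by apply: ge0_ler_powR => //; rewrite ?nnegrE ?powR_ge0 ?ltW.
Unshelve. all: by end_near.
Qed.

(** For an exponent in [[0, 1]], [x^m] lies between [1] and [x]. *)
Lemma dist1_powR_le {R : realType} (x m : R) : 0 < x -> 0 <= m <= 1 ->
  `|x `^ m - 1| <= `|x - 1|.
Proof.
move=> x0 /andP[m0 m1]; have [x1|x1] := leP x 1.
  have h1 := @ger1_powR _ x m; have h2 := @ger_powR _ x.
  have xm : x <= x `^ m by apply: h1 => //; rewrite x0.
  have xm1 : x `^ m <= 1 by rewrite -[leRHS](powRr0 x) h2// x0.
  by rewrite !ler0_norm ?subr_le0// lerN2 lerD2r.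
have xm1 : 1 <= x `^ m by rewrite -[leLHS](powRr0 x) ler_powR// ltW.
have xm : x `^ m <= x by rewrite ler1_powR// ltW.
by rewrite !ger0_norm ?subr_ge0// ?lerD2r// ltW.
Qed.

(** Dividing by [N] reduces to [x = t / N]. The power is taken at [N] on whichever side of [N] the
    time [t] lies; this controls the drift of the centre of [Omega t]. *)
Lemma dist_powR_le {R : realType} (t N m : R) : 0 < t -> 0 < N -> 0 <= m <= 1 ->
  `|t `^ m - N `^ m| <= N `^ (m - 1) * `|t - N|.
Proof.
move=> t0 N0 m01; have tN : 0 < t / N by rewrite divr_gt0.
have -> : t `^ m - N `^ m = N `^ m * ((t / N) `^ m - 1).
  by rewrite mulrBr mulr1 -powRM ?ltW// mulrC divfK ?gt_eqF.
have Nn0 : N != 0 by rewrite gt_eqF.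
rewrite powRB ?Nn0 ?implybT// (powRr1 (ltW N0)) normrM ger0_norm ?powR_ge0//.
rewrite -mulrA ler_wpM2l ?powR_ge0//; apply: le_trans (dist1_powR_le _ _ tN m01) _.
have -> : t / N - 1 = N^-1 * (t - N) by field; rewrite gt_eqF.
by rewrite normrM gtr0_norm ?invr_gt0.
Qed.

Lemma powR_le_double {R : realType} (t N p : R) : 0 < t -> 0 < N -> t <= 2 * N ->
  0 <= p <= 1 -> t `^ p <= 2 * N `^ p.
Proof.
move=> t0 N0 tN /andP[p0 p1].
have h2 : (2 : R) `^ p <= 2 by rewrite ler1_powR// ler1n.
apply: (@le_trans _ _ ((2 * N) `^ p)).
  by apply: ge0_ler_powR => //; rewrite nnegrE ?mulr_ge0 ?ltW.
by rewrite (powRM p (ler0n R 2) (ltW N0)) ler_wpM2r// powR_ge0.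
Qed.

Lemma Rintegral_sqr_le_Lnorm2 d (T : measurableType d) (R : realType)
    (mu : {measure set T -> \bar R}) (f : T -> R) (M : R) :
  f \in Lfun mu 2%:E -> ('N[mu]_2%:E[EFin \o f] <= M%:E)%E ->
  \int[mu]_x (f x ^+ 2) <= M ^+ 2.
Proof.
move=> fL fM.
have M0 : 0 <= M by rewrite -lee_fin (le_trans _ fM)// Lnorm_ge0.
have i2 := Lfun2_integrable_sqr fL.
have E : (\int[mu]_x (f x ^+ 2)%:E = ('N[mu]_2%:E[EFin \o f]) `^ 2)%E.
  rewrite powR_Lnorm//; apply: eq_integral => x _ /=.
  by rewrite powR_mulrn// real_normK// num_real.
have : (\int[mu]_x (f x ^+ 2)%:E <= (M ^+ 2)%:E)%E.
  rewrite E -powR_mulrn// -poweR_EFin gt0_ler_poweR// in_itv/= ?leey ?Lnorm_ge0//.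
  by rewrite lee_fin M0.
by move=> h; rewrite /Rintegral -[leRHS]/(fine (M ^+ 2)%:E) fine_le// integrable_fin_num.
Qed.

(** A positive lower limit gives a neighbourhood of [+oo], hence a half-line, on which [f] has a
    positive infimum. *)
Lemma limf_einf_pinfty_eq0 {R : realType} (f : R -> \bar R) :
  (forall t, 0 <= f t)%E ->
  (forall c T : R, 0 < c -> (forall t, T < t -> (c%:E <= f t)%E) -> False) ->
  limf_einf f +oo%R = 0%E.
Proof.
move=> f0 fc; rewrite limf_einfE; apply: le_anti; apply/andP; split; last first.
  apply: (@le_trans _ _ (ereal_inf (f @` setT))).
    by apply: le_ereal_inf_tmp => _ [t _ <-].
  by apply: ereal_sup_ubound; exists setT => //; exact: filterT.
rewrite leNgt; apply/negP => /ereal_sup_gt[_ [V [T [_ TV]] <-] V0].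
have inff t : T < t -> (ereal_inf (f @` V) <= f t)%E.
  by move=> tT; apply: ereal_inf_lbound; exists t => //; exact: TV.
move: V0 inff; case: (ereal_inf (f @` V)) => [c V0 inff|_ inff|//].
  exact: (fc c T V0 inff).
(* If the infimum is infinite, any positive constant serves. *)
by apply: (fc 1 T ltr01) => t /inff; apply: le_trans; exact: leey.
Qed.

Lemma measurable_Omega {R : realType} (b r m n s1 s2 t : R) :
  measurable (Omega b r m n s1 s2 t : set (measurableTypeR R * measurableTypeR R)).
Proof.
rewrite (_ : Omega _ _ _ _ _ _ _ =
  `]- (s1 * t `^ m) - t `^ b, - (s1 * t `^ m) + t `^ b[%classic `*`
  `]- (s2 * t `^ n) - t `^ (b * r), - (s2 * t `^ n) + t `^ (b * r)[%classic).
  by apply: measurableX; exact: measurable_itv.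
apply/seteqP; split=> -[x y] /=; rewrite /Omega /= !in_itv /= !ltr_norml.
  by move=> [/andP[? ?] /andP[? ?]]; split; apply/andP; split; lra.
by move=> [/andP[? ?] /andP[? ?]]; split; apply/andP; split; lra.
Qed.

(** The half-width at time [t] is at most [2 N^b] and the centre has moved by at most [N^b]: hence
    the factor [3], the same as in the profiles. *)
Lemma drifting_interval_subset {R : realType} (x b m sg t N L : R) :
  sg = 1 \/ sg = -1 -> 0 < t -> 0 < N -> t <= 2 * N -> 0 <= b <= 1 ->
  0 <= m <= 1 -> `|t - N| <= L -> N `^ (m - 1) * L <= N `^ b ->
  `|x + sg * t `^ m| < t `^ b -> `|x - - (sg * N `^ m)| <= 3 * N `^ b.
Proof.
move=> hsg t0 N0 tN b01 m01 tL NL hx; rewrite opprK.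
have h1 := powR_le_double _ _ _ t0 N0 tN b01.
have h2 : `|sg * (N `^ m - t `^ m)| <= N `^ b.
  have -> : `|sg * (N `^ m - t `^ m)| = `|t `^ m - N `^ m|.
    by rewrite normrM distrC; case: hsg => ->; rewrite ?normrN normr1 mul1r.
  apply: le_trans (dist_powR_le _ _ _ t0 N0 m01) _; apply: le_trans NL.
  by rewrite ler_wpM2l ?powR_ge0.
rewrite (_ : x + _ = (x + sg * t `^ m) + sg * (N `^ m - t `^ m)); last by ring.
apply: le_trans (ler_normD _ _) _; lra.
Qed.

(** * Choice of the scales and contradiction at large times *)

Theorem mainTheorem6 (R : realType) (r b m n s1 s2 : R)
  (hr : 3^-1 < r < 3)
  (hb : 0 < b < 2 / (3 + r))
  (hm : 0 <= m < 1 - 2^-1 * b * (1 + r))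
  (hn : 0 <= n < 1 - 2^-1 * b * (3 - r))
  (hs1 : s1 = 1 \/ s1 = -1)
  (hs2 : s2 = 1 \/ s2 = -1)
  (u0 : R * R -> R) (hu0 : u0 \in Lfun (leb2 R) 2%:E)
  (u : R -> R * R -> R)
  (hu : ZK_solution u0 u)
  (hbd : bounded_L2 u) :
  limf_einf
    (fun t : R => \int[leb2 R]_(p in Omega b r m n s1 s2 t)
                    (u t p ^+ 2)%:E)%E
    +oo%R = 0%E.
Proof.
move: hr hb hm hn => /andP[r1 r2] /andP[b0 b1] /andP[m0 m1] /andP[n0 n1].
have [[uL _] _ uZK] := hu.
have [M0 uM0] := hbd.
have uM t : \int[leb2 R]_p (u t p ^+ 2) <= M0 ^+ 2.
  exact: Rintegral_sqr_le_Lnorm2 (uL t) (uM0 t).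
apply: limf_einf_pinfty_eq0 => [t|c T c0 hT].
  by apply: integral_ge0 => p _; rewrite lee_fin sqr_ge0.
have [D D0 hD] := virial_estimate u (M0 ^+ 2) c uL uM uZK c0.
have r0 : 0 < r by lra.
have r30 : 0 < 3 + r by lra.
have b3r : b * (3 + r) < 2 by rewrite -ltr_pdivlMr.
have br0 : 0 < b * r by rewrite mulr_gt0.
have bb : 0 < b * (3 - r) by rewrite mulr_gt0//; lra.
have bb' : 0 < b * (3 * r - 1) by rewrite mulr_gt0//; lra.
have b01 : 0 <= b <= 1 by clear -r0 b0 b3r; apply/andP; split; nra.
(* [b r < 3 b] and [b r < 2 - 3 b] add up to [b r < 1]. *)
have br01 : 0 <= b * r <= 1 by clear -br0 bb b3r; apply/andP; split; lra.
have m01 : 0 <= m <= 1 by clear -m0 m1 b0 br0; apply/andP; split; lra.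
have n01 : 0 <= n <= 1 by clear -n0 n1 bb; apply/andP; split; lra.
(* [N^q] is the square root of [N^b N^(b r)], that is, the scale [s]. *)
pose q := 2^-1 * (b * (1 + r)).
have D2 : 0 < 2 * D by rewrite mulr_gt0.
have D4 : 0 < 4 * D by rewrite mulr_gt0.
near (pinfty_nbhs R) => N.
have N0 : 0 < N by near: N; exact: nbhs_pinfty_gt.
have Nn0 : N != 0 by rewrite gt_eqF.
(* Since [L <= N / 2], every time in the window is then beyond [T]. *)
have NT : 2 * T < N by near: N; apply: nbhs_pinfty_gt; exact: num_real.
(* The five exponents are negative by the conditions on [b], [m], [n], by [r < 3] and by [3^-1 < r],
   in this order. With [L = 2 D s N^b], [e1] gives [L <= N / 2], [e2] and [e3] bound the drift in
   [x] and in [y], [e4] and [e5] the dispersive terms. *)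
have e1 : 4 * D * N `^ (q + b - 1) <= 1.
  by near: N; apply: near_pinfty_powR_le1 => //; rewrite /q; clear -b3r; lra.
have e2 : 2 * D * N `^ (q + b - b + (m - 1)) <= 1.
  by near: N; apply: near_pinfty_powR_le1 => //; rewrite /q; clear -m1 m0 b0; lra.
have e3 : 2 * D * N `^ (q + b - b * r + (n - 1)) <= 1.
  by near: N; apply: near_pinfty_powR_le1 => //; rewrite /q; clear -n1; lra.
have e4 : 2 * D * N `^ (q - b - b) <= 1.
  by near: N; apply: near_pinfty_powR_le1 => //; rewrite /q; clear -bb b0; lra.
have e5 : 2 * D * N `^ (q - b * r - b * r) <= 1.
  by near: N; apply: near_pinfty_powR_le1 => //; rewrite /q; clear -bb'; lra.
have pD x y : N `^ (x + y) = N `^ x * N `^ y by rewrite powRD// Nn0 implybT.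
have pB x y : N `^ (x - y) = N `^ x / N `^ y by rewrite powRB// Nn0 implybT.
have p1 : N `^ 1 = N by exact: powRr1 (ltW N0).
have sad : (N `^ q) ^+ 2 = N `^ b * N `^ (b * r).
  by rewrite expr2 -!pD (_ : q + q = b + b * r)// /q; clear; field.
have E1 : N `^ (q + b - 1) = N `^ q * N `^ b / N by rewrite pB pD p1.
have E2 : N `^ (q + b - b + (m - 1)) =
    N `^ q * N `^ b / N `^ b * N `^ (m - 1).
  by rewrite (pD (q + b - b)) (pB (q + b)) (pD q).
have E3 : N `^ (q + b - b * r + (n - 1)) =
    N `^ q * N `^ b / N `^ (b * r) * N `^ (n - 1).
  by rewrite (pD (q + b - b * r)) (pB (q + b)) (pD q).
have E4 : N `^ (q - b - b) = N `^ q / N `^ b / N `^ b by rewrite (pB (q - b)) (pB q).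
have E5 : N `^ (q - b * r - b * r) = N `^ q / N `^ (b * r) / N `^ (b * r).
  by rewrite (pB (q - b * r)) (pB q).
move: e1 e2 e3 e4 e5 sad; rewrite {}E1 {}E2 {}E3 {}E4 {}E5.
(* These powers of [N] become opaque variables, so that most of what remains is rational
   arithmetic. *)
have [a aE] : exists a, N `^ b = a by exists (N `^ b).
have [d dE] : exists d, N `^ (b * r) = d by exists (N `^ (b * r)).
have [s sE] : exists s, N `^ q = s by exists (N `^ q).
have a_gt0 : 0 < a by rewrite -aE powR_gt0.
have d_gt0 : 0 < d by rewrite -dE powR_gt0.
have s_gt0 : 0 < s by rewrite -sE powR_gt0.
rewrite aE dE sE => e1 e2 e3 e4 e5 sad.
(* Twice the bound on [L] that [hD] yields, which is the contradiction sought. *)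
have [L LE] : exists L, L = 2 * D * s * a by exists (2 * D * s * a).
have L_gt0 : 0 < L by rewrite LE !mulr_gt0.
have LN : 2 * L <= N.
  move: e1; rewrite mulrA ler_pdivrMr// mul1r => e1.
  apply: le_trans e1; by rewrite LE; clear; lra.
have La : N `^ (m - 1) * L <= a.
  rewrite LE [leLHS](_ : _ = 2 * D * (s * a / a * N `^ (m - 1)) * a).
    by rewrite ler_piMl// ltW.
  by rewrite mulfK ?gt_eqF//; clear; ring.
have Ld : N `^ (n - 1) * L <= d.
  rewrite LE [leLHS](_ : _ = 2 * D * (s * a / d * N `^ (n - 1)) * d).
    by rewrite ler_piMl// ltW.
  by clear -d_gt0; field; rewrite gt_eqF.
have hLsa := hD a d s L N (- (s1 * N `^ m)) (- (s2 * N `^ n)) a_gt0 d_gt0 s_gt0 sad L_gt0.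
suff : L <= D * s * a.
  have : 0 < D * s * a by rewrite !mulr_gt0.
  by rewrite LE; clear; lra.
apply: hLsa => [t tN|].
- have /andP[tl tu] : N - L <= t <= N + L by rewrite -ler_distl.
  have t0 : 0 < t by clear -tl LN N0; lra.
  have t2 : t <= 2 * N by clear -tu LN N0; lra.
  exists (Omega b r m n s1 s2 t); split; first exact: measurable_Omega.
    move=> p [h1 h2]; split.
      by rewrite -aE; apply: (drifting_interval_subset p.1 b m s1 t N L) => //; rewrite aE.
    rewrite -dE; apply: (drifting_interval_subset p.2 (b * r) n s2 t N L) => //.
    by rewrite dE.
  by apply: hT; clear -tl LN NT; lra.
(* [e4] and [e5] bound the two terms by [1 / 2] each. *)
- rewrite mulrDr (_ : D * s * a^-1 ^+ 2 = 2^-1 * (2 * D * (s / a / a))); last first.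
    by clear -a_gt0; field; rewrite gt_eqF.
  rewrite (_ : D * s * d^-1 ^+ 2 = 2^-1 * (2 * D * (s / d / d))); last first.
    by clear -d_gt0; field; rewrite gt_eqF.
  by clear -e4 e5; lra.
Unshelve. all: by end_near.
Qed.
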